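(* Let $n\ge 2$ be an integer and let $A\subseteq\mathbb{F}_{2^{n-1}}\setminus\{0\}$ with $|A|=k\ge 2$ and $r(A)\neq k(k-1)$. Then there exists a subset of $\mathbb{F}_{2^n}\setminus\{0\}$ of size $k+3$ whose $r$-value is $r(A)+12$.
   Context: For a subset $X$ of a finite additive abelian group, the $r$-value $r(X)$ is the number of ordered pairs $(x,y)\in X\times X$ with $x+y\in X$. Only the additive group of $\mathbb{F}_{2^n}$ is used: its elements are written as vectors $[\alpha_1,\dots,\alpha_n]$ with $\alpha_i\in\{0,1\}$ and addition coordinatewise modulo 2. By convention $\mathbb{F}_{2^{n-1}}$ is regarded as the subset of $\mathbb{F}_{2^n}$ consisting of the vectors with first coordinate $\alpha_1=0$. *)

(* Defs.v *)
From mathcomp Require Import all_boot all_order all_algebra.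

Set Implicit Arguments.
Unset Strict Implicit.
Unset Printing Implicit Defensive.

Import GRing.Theory.
Local Open Scope ring_scope.

Definition rvalue (V : finZmodType) (X : {set V}) : nat :=
  #|[set p in setX X X | p.1 + p.2 \in X]|.

(* The copy of the field with 2^(n-1) elements inside the field with 2^n
   elements, seen as the additive group 'rV['F_2]_n.  The quantifier over i
   picks out the first coordinate without assuming that n is m.+1. *)
Definition half_space (n : nat) : {set 'rV['F_2]_n} :=
  [set v : 'rV['F_2]_n | [forall i : 'I_n, (i == 0%N :> nat) ==> (v 0 i == 0)]].

(* Main.v *)
Require Import Defs.
From mathcomp Require Import all_boot all_order all_algebra.

(** The new set is obtained from [A], which lies in a hyperplane [H], by adding
    a small piece [e + C] of the other coset of [H], with [C] inside [H].  A
    solution of [x + y = z] in [A :|: (e + C)] has either no entry or exactly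
    two entries outside [H].  Solutions of the first kind lie in [A] and are
    counted by [rvalue A].  In characteristic 2 the equation is symmetric in
    [x], [y], [z], so the remaining solutions split, by the position of the
    entry in [H], into three families of the same size, namely the number of
    pairs [(c, d)] in [C] with [c + d] in [A] (lemma [rvalue_coset_extension]).

    A gain of 12 therefore needs exactly 4 such ordered pairs.  For
    [C = {0, a, b}] the sums of two distinct elements are [a], [b] and [a + b],
    so it is enough to have distinct [a], [b] in [A] with [a + b] outside [A].
    Such a pair exists because otherwise all [k (k - 1)] ordered pairs of
    distinct elements of [A] would be counted by [rvalue A] (lemma
    [rvalue_missing_sum]). *)

Set Implicit Arguments.
Unset Strict Implicit.
Unset Printing Implicit Defensive.

Import GRing.Theory.
Local Open Scope ring_scope.

Lemma rvalueE (V : finZmodType) (X : {set V}) :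
  rvalue X = (\sum_(x in X) \sum_(y in X) ((x + y)%R \in X))%N.
Proof.
rewrite /rvalue -sum1_card pair_big_dep /= big_mkcond /=.
rewrite [RHS]big_mkcond /=; apply: eq_bigr => -[x y] _.
by rewrite !inE /=; do 3 case: (_ \in X).
Qed.

Section ElementaryAbelian2.

Variable V : finZmodType.
Hypothesis addvv : forall x : V, x + x = 0.

Let addvK (x y : V) : x + y + y = x.
Proof. by rewrite -addrA addvv addr0. Qed.

(** The diagonal pairs never count, since their sum is 0; so if no pair of
    distinct elements had its sum outside [A], the count would be maximal. *)
Lemma rvalue_missing_sum (A : {set V}) :
    0 \notin A -> rvalue A <> (#|A| * (#|A| - 1))%N ->
  exists a b, [/\ a \in A, b \in A, a != b & a + b \notin A].
Proof.
move=> A0 rA.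
case: (boolP [exists a in A, exists b in A, (a != b) && (a + b \notin A)]).
  case/exists_inP=> a aA /exists_inP[b bA /andP[ab abA]].
  by exists a, b.
move=> noab; case: rA; rewrite rvalueE -sum_nat_const.
apply: eq_bigr => a aA; rewrite (cardsD1 a A) aA add1n subn1 /=.
rewrite -sum1_card (big_setD1 a) //= addvv (negPf A0) add0n.
apply: eq_bigr => b; rewrite !inE => /andP[ba bA].
move: noab; rewrite negb_exists_in => /forall_inP/(_ a aA).
rewrite negb_exists_in => /forall_inP/(_ b bA).
by rewrite eq_sym ba /= negbK => ->.
Qed.

(** The factor 3 is the number of positions that the entry in [H] can take in a
    solution of [x + y = z] with two entries in the coset [e + H]. *)
Lemma rvalue_coset_extension (H A C : {set V}) (e : V) :
    {in H &, forall x y, x + y \in H} -> A \subset H -> C \subset H ->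
    e \notin H ->
  rvalue (A :|: [set e + c | c in C]) =
    (rvalue A + 3 * \sum_(c in C) \sum_(d in C) ((c + d)%R \in A))%N.
Proof.
move=> addH /subsetP AH /subsetP CH eH; set T := [set e + c | c in C].
have eN x : x \in H -> e + x \notin H.
  by move=> xH; apply: contra eH => /addH/(_ xH); rewrite addvK.
have inT x : (e + x \in T) = (x \in C) by rewrite mem_imset //; apply: addrI.
have inTN x : x \in H -> x \notin T.
  by move=> xH; apply/imsetP=> -[c /CH/eN eC xE]; rewrite -xE xH in eC.
have inAN x : x \in H -> e + x \notin A.
  by move=> /eN; apply: contra => /AH.
have AT : [disjoint A & T].
  by rewrite disjoint_subset; apply/subsetP=> x /AH/inTN; rewrite inE.
have bigT (F : V -> nat) :
    (\sum_(x in T) F x = \sum_(c in C) F (e + c)%R)%N.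
  by rewrite big_imset // => x y _ _ /addrI.
have bigAT (F : V -> nat) :
    (\sum_(x in A :|: T) F x =
     \sum_(x in A) F x + \sum_(c in C) F (e + c)%R)%N.
  rewrite -bigT -bigU //; apply: eq_bigl => x.
  by rewrite !inE.
(* For a fixed [c], the equations [a + c = d] and [c + d = a] are equivalent. *)
have swap c :
    (\sum_(a in A) ((a + c)%R \in C) = \sum_(d in C) ((c + d)%R \in A))%N.
  rewrite [LHS]big_mkcond (reindex_inj (addrI c)) [RHS]big_mkcond.
  apply: eq_bigr => d _ /=; rewrite (addrC c d) addvK.
  by do 2 case: (_ \in _).
rewrite 2!rvalueE bigAT !mulSn mul0n addn0.
under eq_bigr => x xA do rewrite bigAT.
under [X in (_ + X)%N]eq_bigr => x xA do rewrite bigAT.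
rewrite !big_split /= -addnA; congr (_ + (_ + (_ + _)))%N.
- apply: eq_bigr => x /AH xH; apply: eq_bigr => y /AH yH.
  by rewrite inE (negPf (inTN _ (addH _ _ xH yH))) orbF.
- rewrite exchange_big; apply: eq_bigr => c cC; rewrite -swap.
  apply: eq_bigr => a /AH aH; rewrite addrCA inE inT.
  by rewrite (negPf (inAN _ (addH _ _ aH (CH c cC)))).
- apply: eq_bigr => c cC; rewrite -swap.
  apply: eq_bigr => a /AH aH; rewrite -addrA inE inT (addrC c a).
  by rewrite (negPf (inAN _ (addH _ _ aH (CH c cC)))).
- apply: eq_bigr => c /CH cH; apply: eq_bigr => d /CH dH.
  rewrite addrACA addvv add0r inE (negPf (inTN _ (addH _ _ cH dH))).
  by rewrite orbF.
Qed.

(** Taking [C = {0, a, b}], the pairs of [C] with sum in [A] are [(0, a)],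
    [(0, b)] and their reverses, so the gain is 3 * 4. *)
Lemma rvalue_extension12 (H A : {set V}) (e a b : V) :
    {in H &, forall x y, x + y \in H} -> A \subset H -> e \notin H ->
    0 \notin A -> a \in A -> b \in A -> a != b -> a + b \notin A ->
  exists B : {set V},
    [/\ B \subset [set: V] :\ 0, #|B| = (#|A| + 3)%N
      & rvalue B = (rvalue A + 12)%N].
Proof.
move=> addH AH eH A0 aA bA ab abA.
have [aH bH] : a \in H /\ b \in H by split; apply: (subsetP AH).
have H0 : 0 \in H by rewrite -(addvv a) addH.
have [a0 b0] : a != 0 /\ b != 0.
  by split; apply: contraNneq A0 => <-.
pose C := [set 0; a; b].
have CE : C = 0 |: (a |: [set b]) by rewrite /C setUA.
have CN : (0 \notin a |: [set b]) && (a \notin [set b]).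
  by rewrite !inE negb_or ab ![0 == _]eq_sym a0 b0.
have [C0 Ca] := andP CN.
have CH : C \subset H.
  by apply/subsetP=> x; rewrite !inE -orbA => /or3P[]/eqP->.
have eN x : x \in H -> e + x \notin H.
  by move=> xH; apply: contra eH => /addH/(_ xH); rewrite addvK.
exists (A :|: [set e + c | c in C]); split.
- apply/subsetP=> x; rewrite in_setU in_setD1 in_setT andbT.
  case/orP=> [xA | /imsetP[c cC ->]]; first by apply: contraNneq A0 => <-.
  by apply: contraTneq H0 => <-; apply/eN/(subsetP CH).
- have -> : (#|A| + 3 = #|A| + #|[set (e + c)%R | c in C]|)%N.
    by rewrite card_imset; [rewrite CE !cardsU1 cards1 C0 Ca | apply: addrI].
  rewrite cardsU disjoint_setI0 ?cards0 ?subn0 // disjoint_subset.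
  apply/subsetP=> x xA; rewrite inE; apply/imsetP=> -[c cC xE].
  by have := eN c (subsetP CH c cC); rewrite -xE (subsetP AH).
- rewrite (rvalue_coset_extension addH) //; congr (_ + _)%N.
  rewrite CE; do ![rewrite big_setU1 // | rewrite big_set1].
  by rewrite !addvv !addr0 !add0r (addrC b a) aA bA (negPf A0) (negPf abA).
Qed.

End ElementaryAbelian2.

Lemma half_space_add (n : nat) :
  {in half_space n &, forall x y, x + y \in half_space n}.
Proof.
move=> x y; rewrite !inE => /forallP Hx /forallP Hy; apply/forallP => i.
apply/implyP=> i0; rewrite mxE.
have /eqP-> := implyP (Hx i) i0; have /eqP-> := implyP (Hy i) i0.
by rewrite addr0.
Qed.

Lemma half_space_proper (n : nat) :
  (0 < n)%N -> exists e : 'rV['F_2]_n, e \notin half_space n.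
Proof.
move=> n0; exists (const_mx 1); rewrite inE; apply/negP=> /forallP.
by move=> /(_ (Ordinal n0)); rewrite mxE.
Qed.

Lemma rV2_addvv (n : nat) (x : 'rV['F_2]_n) : x + x = 0.
Proof.
by apply/rowP=> i; rewrite !mxE addrr_pchar2 // pchar_Fp.
Qed.

Theorem proposition4p6 (n : nat) (hn : (2 <= n)%N)
    (A : {set 'rV['F_2]_n}) (k : nat)
    (hA : A \subset half_space n :\ 0)
    (hcard : #|A| = k) (hk : (2 <= k)%N)
    (hr : rvalue A <> (k * (k - 1))%N) :
  exists B : {set 'rV['F_2]_n},
    [/\ B \subset [set: 'rV['F_2]_n] :\ 0,
        #|B| = (k + 3)%N
      & rvalue B = (rvalue A + 12)%N].
Proof.
move: hA; rewrite subsetD1 => /andP[AH A0].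
have [e eH] := half_space_proper (ltnW hn).
rewrite -hcard in hr *.
have [a [b [aA bA ab abA]]] := rvalue_missing_sum (@rV2_addvv n) A0 hr.
exact: (rvalue_extension12 (@rV2_addvv n) (@half_space_add n) AH eH A0 aA bA).
Qed.
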